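(* Let $\phi:\mathbb{C}_0\to\mathbb{C}_0$ be a non-constant analytic function of the form $\phi(s)=c_0 s+\varphi(s)$ with $c_0\in\mathbb{N}_0$ and $\varphi\in\mathcal{D}$, such that $f\circ\phi\in\mathcal{A}^+$ for every $f\in\mathcal{A}^+$, so that $C_\phi f=f\circ\phi$ defines a composition operator $C_\phi:\mathcal{A}^+\to\mathcal{A}^+$. Then $C_\phi$ is an isometry (i.e. $\|C_\phi f\|_{\mathcal{A}^+}=\|f\|_{\mathcal{A}^+}$ for all $f\in\mathcal{A}^+$) if and only if $\phi(s)=c_0s+i\tau$ with $c_0\in\mathbb{N}=\{1,2,\dots\}$ and $\tau\in\mathbb{R}$.
   Context: For $\theta\in\mathbb{R}$, $\mathbb{C}_\theta=\{s\in\mathbb{C}:\operatorname{Re}s>\theta\}$. The Wiener–Dirichlet algebra $\mathcal{A}^+$ is the set of functions $f(s)=\sum_{n\ge1}a_n n^{-s}$ with $\|f\|_{\mathcal{A}^+}=\sum_{n\ge1}|a_n|<\infty$, viewed as functions on $\{\operatorname{Re}s\ge0\}$; it is a commutative unital Banach algebra under pointwise multiplication. $\mathcal{D}$ denotes the space of analytic functions $\mathbb{C}_0\to\mathbb{C}$ representable by a convergent Dirichlet series $\sum_{n\ge1}c_n n^{-s}$ for $\operatorname{Re}s$ large enough. $\mathbb{N}_0=\{0,1,2,\dots\}$. *)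

(* Defs.v *)
From Stdlib Require Import Reals.
From Coquelicot Require Import Coquelicot.
Open Scope R_scope.

Definition in_half_plane (theta : R) (s : C) : Prop := theta < Re s.
Definition in_closed_rhp (s : C) : Prop := 0 <= Re s.

(* n^{-s} = exp(-s log n) for n >= 1, written out:
   n^{-s} = n^{-Re s} (cos(Im s log n) - i sin(Im s log n)). *)
Definition npow_neg (n : nat) (s : C) : C :=
  let L := ln (INR n) in
  (exp (- Re s * L) * cos (Im s * L), - (exp (- Re s * L) * sin (Im s * L))).

(* Coefficient sequences are indexed by n >= 1: the coefficient of n^{-s}
   is a n; a 0 is ignored. The k-th term of the Dirichlet series is the
   term for n = k+1. *)
Definition ds_term (a : nat -> C) (s : C) (k : nat) : C :=
  Cmult (a (S k)) (npow_neg (S k) s).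

Definition ds_converges_to (a : nat -> C) (s : C) (l : C) : Prop :=
  is_series (K := C_AbsRing) (V := C_NormedModule) (ds_term a s) l.

Definition abs_summable (a : nat -> C) : Prop :=
  ex_series (fun k => Cmod (a (S k))).

Definition l1_norm (a : nat -> C) : R := Series (fun k => Cmod (a (S k))).

Definition represents_on (U : C -> Prop) (a : nat -> C) (f : C -> C) : Prop :=
  forall s, U s -> ds_converges_to a s (f s).

Definition Aplus_coeffs (a : nat -> C) (f : C -> C) : Prop :=
  abs_summable a /\ represents_on in_closed_rhp a f.

Definition in_Aplus (f : C -> C) : Prop := exists a, Aplus_coeffs a f.

Definition C_differentiable_at (f : C -> C) (z : C) : Prop :=
  ex_derive (K := C_AbsRing) (V := C_NormedModule) f z.

Definition analytic_on (U : C -> Prop) (f : C -> C) : Prop :=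
  forall z, U z -> C_differentiable_at f z.

Definition in_D (g : C -> C) : Prop :=
  analytic_on (in_half_plane 0) g /\
  exists (c : nat -> C) (sigma : R),
    forall s, in_half_plane sigma s -> ds_converges_to c s (g s).

(* Composition operator on A^+ is isometric:
   whenever f in A^+ has coefficients a and f o phi (as an element of A^+,
   i.e. represented on C_0 and hence on its closure) has coefficients b,
   the norms agree. *)
Definition Cphi_maps_Aplus (phi : C -> C) : Prop :=
  forall f, in_Aplus f ->
    exists b, abs_summable b /\
      represents_on (in_half_plane 0) b (fun s => f (phi s)).

Definition Cphi_isometry (phi : C -> C) : Prop :=
  forall (f : C -> C) (a b : nat -> C),
    Aplus_coeffs a f ->
    abs_summable b ->
    represents_on (in_half_plane 0) b (fun s => f (phi s)) ->
    l1_norm b = l1_norm a.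

Definition iR (tau : R) : C := (0%R, tau).

(* Main.v *)
(** Write [u_n = n^{-phi}], an element of A^+ whose lowest term is
    [n^{-l} (n^{c0})^{-s}] with [l = lim varphi(x)], [x -> +oo].  If [C_phi] is
    isometric then [|u_n +- u_k| = |u_n| + |u_k| = 2], which forces the coefficient
    supports of the [u_n] to be pairwise disjoint; in particular [c0 >= 1], since for
    [c0 = 0] they all contain 1.  Suppose [u_n = alpha A^{-s} + w], [A = n^{c0}], with
    [w] of lowest term [gamma m^{-s}], [gamma <> 0].  The product
    [u_n^{c0} w^{c0}] has the nonzero coefficient [(alpha gamma)^{c0}] at [(A m)^{c0}].
    On the other hand, expanding [w = u_n - alpha A^{-s}], that coefficient is a
    combination of coefficients of [u_n^q = u_{n^q}], [q >= c0], at the index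
    [A^{q-c0} m^{c0} = N^{c0}], [N = n^{q-c0} m], where [u_N] has its lowest term: by
    disjointness they vanish.  Hence [w = 0], so [n^{-varphi} = n^{-l}] for all [n],
    [varphi = l], and [Re l = 0] because [u_2] has norm 1. *)

Require Import Defs.
From Stdlib Require Import Reals Lra Lia Classical.
From Coquelicot Require Import Coquelicot.
Open Scope R_scope.

(** * Arithmetic and modulus of n^{-s} *)

Lemma exp_le_compat (x y : R) : x <= y -> exp x <= exp y.
Proof. intros [H | ->]; [apply Rlt_le; now apply exp_increasing | apply Rle_refl]. Qed.

Lemma C_ext (z w : C) : Re z = Re w -> Im z = Im w -> z = w.
Proof. destruct z, w; simpl; congruence. Qed.

Lemma npow_neg_plus (n : nat) (s t : C) :
  npow_neg n (Cplus s t) = Cmult (npow_neg n s) (npow_neg n t).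
Proof.
  apply C_ext; unfold npow_neg, Re, Im; simpl.
  - replace (- (fst s + fst t) * ln (INR n)) with (- fst s * ln (INR n) + - fst t * ln (INR n)) by ring.
    rewrite exp_plus.
    replace ((snd s + snd t) * ln (INR n)) with (snd s * ln (INR n) + snd t * ln (INR n)) by ring.
    rewrite cos_plus; ring.
  - replace (- (fst s + fst t) * ln (INR n)) with (- fst s * ln (INR n) + - fst t * ln (INR n)) by ring.
    rewrite exp_plus.
    replace ((snd s + snd t) * ln (INR n)) with (snd s * ln (INR n) + snd t * ln (INR n)) by ring.
    rewrite sin_plus; ring.
Qed.

Lemma npow_neg_mult (n m : nat) (s : C) : (1 <= n)%nat -> (1 <= m)%nat ->
  npow_neg (n * m) s = Cmult (npow_neg n s) (npow_neg m s).
Proof.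
  intros Hn Hm.
  assert (E : ln (INR (n * m)) = ln (INR n) + ln (INR m)).
  { rewrite mult_INR; apply ln_mult; apply lt_0_INR; lia. }
  apply C_ext; unfold npow_neg, Re, Im; rewrite E; simpl.
  - rewrite !Rmult_plus_distr_l, exp_plus, cos_plus; ring.
  - rewrite !Rmult_plus_distr_l, exp_plus, sin_plus; ring.
Qed.

Lemma npow_neg_1 (s : C) : npow_neg 1 s = RtoC 1.
Proof.
  apply C_ext; unfold npow_neg, Re, Im; simpl; rewrite ln_1, !Rmult_0_r, exp_0, ?cos_0, ?sin_0; ring.
Qed.

Lemma npow_neg_0 (n : nat) : npow_neg n (RtoC 0) = RtoC 1.
Proof.
  apply C_ext; unfold npow_neg, Re, Im; simpl; rewrite ?Ropp_0, !Rmult_0_l, exp_0, ?cos_0, ?sin_0; ring.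
Qed.

Lemma pow_ge_1 (n k : nat) : (1 <= n)%nat -> (1 <= n ^ k)%nat.
Proof. intros Hn; assert (n ^ k <> 0)%nat by (apply Nat.pow_nonzero; lia); lia. Qed.

Lemma npow_neg_pow (n k : nat) (s : C) : (1 <= n)%nat ->
  npow_neg (n ^ k) s = Cpow (npow_neg n s) k.
Proof.
  intros Hn; induction k as [|k IH].
  - apply npow_neg_1.
  - rewrite Nat.pow_succ_r', Cpow_S, <- IH.
    apply npow_neg_mult; [exact Hn | now apply pow_ge_1].
Qed.

(** Together with [npow_neg_pow] this identifies n^{-ks} with (n^k)^{-s}: the linear part of a
    symbol moves the frequency n to its k-th power. *)
Lemma npow_neg_INR_mult (n k : nat) (s : C) :
  npow_neg n (Cmult (RtoC (INR k)) s) = Cpow (npow_neg n s) k.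
Proof.
  induction k as [|k IH].
  - simpl INR. rewrite Cmult_0_l; apply npow_neg_0.
  - rewrite S_INR, Cpow_S, <- IH, <- npow_neg_plus; f_equal.
    rewrite RtoC_plus; ring.
Qed.

Lemma Cmod_npow_neg (n : nat) (s : C) : Cmod (npow_neg n s) = exp (- Re s * ln (INR n)).
Proof.
  unfold Cmod, npow_neg; simpl.
  set (e := exp _); set (t := Im s * _).
  match goal with |- sqrt ?a = _ => replace a
    with (Rsqr e * (Rsqr (sin t) + Rsqr (cos t))) by (unfold Rsqr; ring) end.
  rewrite sin2_cos2, Rmult_1_r.
  apply sqrt_Rsqr; apply Rlt_le, exp_pos.
Qed.

Lemma npow_neg_neq_0 (n : nat) (s : C) : npow_neg n s <> RtoC 0.
Proof. apply Cmod_gt_0; rewrite Cmod_npow_neg; apply exp_pos. Qed.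

(** * Series of complex numbers: domination and one-term series *)

Notation is_cseries := (@is_series C_AbsRing C_NormedModule).

Lemma is_cseries_eps (u : nat -> C) (l : C) (eps : R) : is_cseries u l -> 0 < eps ->
  exists N, forall n, (N <= n)%nat ->
    Cmod (Cminus (@sum_n C_NormedModule u n) l) < eps.
Proof.
  intros H He.
  destruct (proj1 (filterlim_locally_ball_norm (K := C_AbsRing) (U := C_NormedModule)
                     (sum_n u) l) H (mkposreal eps He)) as [N HN].
  exists N; intros n Hn; exact (HN n Hn).
Qed.

Lemma Cmod_sum_n_le (u : nat -> C) (v : nat -> R) (n : nat) :
  (forall k, Cmod (u k) <= v k) -> Cmod (@sum_n C_NormedModule u n) <= sum_n v n.
Proof.
  intros H; induction n as [|n IH].
  - rewrite !sum_O; apply H.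
  - rewrite !sum_Sn; eapply Rle_trans; [apply Cmod_triangle|].
    apply Rplus_le_compat; auto.
Qed.

(** Replacing both sums by one common partial sum costs at most [eps / 2] on each side, and the
    partial sums compare term by term. *)
Lemma Cmod_cseries_le (u : nat -> C) (l : C) (v : nat -> R) :
  is_cseries u l -> (forall k, Cmod (u k) <= v k) -> ex_series v -> Cmod l <= Series v.
Proof.
  intros Hu Huv Hv; apply le_epsilon; intros eps He.
  destruct (is_cseries_eps u l (eps / 2) Hu ltac:(lra)) as [N HN].
  destruct (proj1 (filterlim_locally_ball_norm (K := R_AbsRing) (U := R_NormedModule)
              (sum_n v) (Series v)) (Series_correct v Hv) (mkposreal (eps / 2) ltac:(lra)))
    as [M HM].
  set (n := max N M).
  specialize (HN n ltac:(lia)). specialize (HM n ltac:(lia)).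
  pose proof (Cmod_sum_n_le u v n Huv) as Hn.
  assert (HM' : Rabs (sum_n v n - Series v) < eps / 2) by exact HM.
  apply Rabs_def2 in HM'.
  replace l with (Cplus (@sum_n C_NormedModule u n) (Copp (Cminus (@sum_n C_NormedModule u n) l))) by ring.
  eapply Rle_trans; [apply Cmod_triangle|]. rewrite Cmod_opp. lra.
Qed.

Lemma ex_series_Rscal (c : R) (v : nat -> R) : ex_series v -> ex_series (fun k => c * v k).
Proof. exact (ex_series_scal (V := R_NormedModule) c v). Qed.

Lemma Cmod_cseries_le_scal (u : nat -> C) (l : C) (c : R) (v : nat -> R) :
  is_cseries u l -> (forall k, Cmod (u k) <= c * v k) -> ex_series v -> Cmod l <= c * Series v.
Proof.
  intros Hu Huv Hv; rewrite <- Series_scal_l.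
  apply Cmod_cseries_le with u; auto. now apply ex_series_Rscal.
Qed.

Lemma is_series_single {K : AbsRing} {V : NormedModule K} (j : nat) (x : V) :
  is_series (fun k => if Nat.eqb k j then x else zero) x.
Proof.
  assert (E : forall M, sum_n (fun k => if Nat.eqb k j then x else zero) M
                = if Nat.leb j M then x else zero).
  { induction M as [|M IH].
    - rewrite sum_O. destruct j; reflexivity.
    - rewrite sum_Sn, IH.
      destruct (Nat.leb_spec j M), (Nat.eqb_spec (S M) j), (Nat.leb_spec j (S M)); try lia.
      + apply plus_zero_r.
      + apply plus_zero_l.
      + apply plus_zero_l. }
  apply filterlim_ext_loc with (fun _ : nat => x).
  - exists j; intros M HM; rewrite E.
    destruct (Nat.leb_spec j M); [reflexivity | lia].
  - apply filterlim_const.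
Qed.

(** * Linear combinations and monomials as Dirichlet series *)

Lemma is_cseries_ext (u v : nat -> C) (l : C) :
  (forall k, u k = v k) -> is_cseries u l -> is_cseries v l.
Proof. exact (is_series_ext (V := C_NormedModule) u v l). Qed.

Lemma is_cseries_plus (u v : nat -> C) (l m : C) :
  is_cseries u l -> is_cseries v m -> is_cseries (fun k => Cplus (u k) (v k)) (Cplus l m).
Proof. exact (is_series_plus (V := C_NormedModule) u v l m). Qed.

Lemma is_cseries_scal (c : C) (u : nat -> C) (l : C) :
  is_cseries u l -> is_cseries (fun k => Cmult c (u k)) (Cmult c l).
Proof. exact (is_series_scal (V := C_NormedModule) c u l). Qed.

(* Unlike [Aplus_coeffs], only asks for the values on the open half-plane. *)
Definition Aplus_rep (a : nat -> C) (f : C -> C) : Prop :=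
  abs_summable a /\ represents_on (in_half_plane 0) a f.

Lemma abs_summable_lin (c d : C) (a b : nat -> C) :
  abs_summable a -> abs_summable b ->
  abs_summable (fun n => Cplus (Cmult c (a n)) (Cmult d (b n))).
Proof.
  intros Ha Hb; unfold abs_summable.
  apply (@ex_series_le R_AbsRing R_CompleteNormedModule) with
    (fun k => Cmod c * Cmod (a (S k)) + Cmod d * Cmod (b (S k))).
  - intros n; change (norm ?x) with (Rabs x).
    rewrite Rabs_pos_eq by apply Cmod_ge_0.
    eapply Rle_trans; [apply Cmod_triangle|]. rewrite !Cmod_mult; lra.
  - apply (@ex_series_plus R_AbsRing R_NormedModule);
      apply ex_series_Rscal; assumption.
Qed.

Lemma represents_on_lin (U : C -> Prop) (c d : C) (a b : nat -> C) (f g : C -> C) :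
  represents_on U a f -> represents_on U b g ->
  represents_on U (fun n => Cplus (Cmult c (a n)) (Cmult d (b n)))
    (fun s => Cplus (Cmult c (f s)) (Cmult d (g s))).
Proof.
  intros Hf Hg s Hs.
  generalize (is_cseries_plus _ _ _ _ (is_cseries_scal c _ _ (Hf s Hs)) (is_cseries_scal d _ _ (Hg s Hs))).
  apply is_cseries_ext; intros n; unfold ds_term; ring.
Qed.

Definition single (n : nat) (x : C) (k : nat) : C := if Nat.eqb k n then x else RtoC 0.

(** The [pred n] in the proof below reflects the index shift: the [k]-th term of a series belongs to
    n = k+1. *)
Lemma represents_single (U : C -> Prop) (n : nat) (x : C) : (1 <= n)%nat ->
  represents_on U (single n x) (fun s => Cmult x (npow_neg n s)).
Proof.
  intros Hn s _.
  generalize (@is_series_single C_AbsRing C_NormedModule (pred n) (Cmult x (npow_neg n s))).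
  apply is_cseries_ext; intros k; unfold ds_term, single.
  destruct (Nat.eqb_spec k (pred n)), (Nat.eqb_spec (S k) n); try lia.
  - subst n; reflexivity.
  - change (RtoC 0 = Cmult (RtoC 0) (npow_neg (S k) s)); ring.
Qed.

Lemma single_norm (n : nat) (x : C) : (1 <= n)%nat ->
  is_series (fun k => Cmod (single n x (S k))) (Cmod x).
Proof.
  intros Hn.
  generalize (@is_series_single R_AbsRing R_NormedModule (pred n) (Cmod x)).
  apply is_series_ext; intros k; unfold single.
  destruct (Nat.eqb_spec k (pred n)), (Nat.eqb_spec (S k) n); try lia; try reflexivity.
  symmetry; apply Cmod_0.
Qed.

Lemma abs_summable_single (n : nat) (x : C) : (1 <= n)%nat -> abs_summable (single n x).
Proof. intros Hn; eexists; apply (single_norm n x Hn). Qed.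

(** * Leading coefficients *)

(** Complex convergence as x -> +oo is stated through the modulus, so that the calculus of real
    limits applies. *)
Definition tends (g : R -> C) (l : C) : Prop :=
  is_lim (fun x => Cmod (Cminus (g x) l)) p_infty 0.

Lemma tends_le (g : R -> C) (l : C) (b : R -> R) :
  (forall x, 0 < x -> Cmod (Cminus (g x) l) <= b x) -> is_lim b p_infty 0 -> tends g l.
Proof.
  intros H Hb; apply is_lim_le_le_loc with (fun _ => 0) b; [| apply is_lim_const | exact Hb].
  exists 0; intros x Hx; split; [apply Cmod_ge_0 | now apply H].
Qed.

Lemma tends_ext (g h : R -> C) (l : C) :
  (forall x, 0 < x -> g x = h x) -> tends g l -> tends h l.
Proof.
  intros H Hg; apply tends_le with (2 := Hg); intros x Hx.
  rewrite H by exact Hx; apply Rle_refl.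
Qed.

Lemma tends_const (l : C) : tends (fun _ => l) l.
Proof.
  apply tends_le with (fun _ => 0); [| apply is_lim_const].
  intros x _; replace (Cminus l l) with (RtoC 0) by ring; rewrite Cmod_0; apply Rle_refl.
Qed.

Lemma tends_mult (g h : R -> C) (l m : C) :
  tends g l -> tends h m -> tends (fun x => Cmult (g x) (h x)) (Cmult l m).
Proof.
  intros Hg Hh.
  apply tends_le with (fun x => Cmod (Cminus (g x) l) * Cmod (Cminus (h x) m)
     + (Cmod l * Cmod (Cminus (h x) m) + Cmod m * Cmod (Cminus (g x) l))).
  - intros x _.
    replace (Cminus (Cmult (g x) (h x)) (Cmult l m)) with
      (Cplus (Cmult (Cminus (g x) l) (Cminus (h x) m))
         (Cplus (Cmult l (Cminus (h x) m)) (Cmult m (Cminus (g x) l)))) by ring.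
    eapply Rle_trans; [apply Cmod_triangle|]. rewrite Cmod_mult.
    apply Rplus_le_compat_l.
    eapply Rle_trans; [apply Cmod_triangle|]. rewrite !Cmod_mult; apply Rle_refl.
  - assert (E1 := is_lim_mult _ _ _ _ _ Hg Hh I).
    assert (E2 := is_lim_scal_l _ (Cmod l) _ _ Hh).
    assert (E3 := is_lim_scal_l _ (Cmod m) _ _ Hg).
    simpl in E1, E2, E3; rewrite Rmult_0_r in E1, E2, E3.
    assert (E := is_lim_plus' _ _ _ _ _ E1 (is_lim_plus' _ _ _ _ _ E2 E3)).
    rewrite !Rplus_0_r in E; exact E.
Qed.

Lemma tends_pow (g : R -> C) (l : C) (k : nat) :
  tends g l -> tends (fun x => Cpow (g x) k) (Cpow l k).
Proof.
  intros H; induction k as [|k IH]; [exact (tends_const (RtoC 1)) | exact (tends_mult _ _ _ _ H IH)].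
Qed.

Lemma tends_unique (g : R -> C) (l m : C) : tends g l -> tends g m -> l = m.
Proof.
  intros Hl Hm.
  assert (E := is_lim_plus' _ _ _ _ _ Hl Hm).
  assert (H : Cmod (Cminus l m) <= 0 + 0).
  { refine (is_lim_le_loc (fun _ => Cmod (Cminus l m)) _ p_infty (Cmod (Cminus l m)) (0 + 0)
             _ (is_lim_const _ _) E).
    exists 0; intros x _.
    replace (Cminus l m) with (Cplus (Copp (Cminus (g x) l)) (Cminus (g x) m)) by ring.
    eapply Rle_trans; [apply Cmod_triangle|]; rewrite Cmod_opp; apply Rle_refl. }
  assert (Z : Cminus l m = RtoC 0).
  { apply Cmod_eq_0; pose proof (Cmod_ge_0 (Cminus l m)); lra. }
  replace l with (Cplus (Cminus l m) m) by ring; rewrite Z; ring.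
Qed.

Lemma is_lim_scal_exp (M c : R) : 0 < c -> is_lim (fun x => M * exp (- x * c)) p_infty 0.
Proof.
  intros Hc.
  replace (Finite 0) with (Rbar_mult M 0) by (simpl; f_equal; ring).
  apply is_lim_scal_l.
  apply is_lim_ext with (fun x => exp (- c * x + 0)); [intros x; f_equal; ring |].
  apply (is_lim_comp_lin exp (- c) 0); [| lra].
  replace (Rbar_plus (Rbar_mult (- c) p_infty) 0) with m_infty; [apply is_lim_exp_m |].
  unfold Rbar_mult, Rbar_mult'; destruct (Rle_dec 0 (- c)); [exfalso; lra | reflexivity].
Qed.

Lemma ln_INR_lt (n m : nat) : (1 <= n < m)%nat -> ln (INR n) < ln (INR m).
Proof. intros H; apply ln_increasing; [apply lt_0_INR | apply lt_INR]; lia. Qed.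

(** The factor n^s, written [npow_neg n (Copp s)], serves below to divide out n^{-s}. *)
Lemma npow_neg_opp (n : nat) (s : C) : Cmult (npow_neg n (Copp s)) (npow_neg n s) = RtoC 1.
Proof.
  rewrite <- npow_neg_plus, <- (npow_neg_0 n); f_equal; ring.
Qed.

(** Once the [K]-th term is subtracted, only terms n >= K+1 remain; at a real x > 0 each is at most
    |d_n| (K+1)^{-x}. After multiplication by K^x the error is at most the norm of [d] times
    (K/(K+1))^x, which tends to 0. *)
Lemma lead_coeff_lim (d : nat -> C) (f : C -> C) (K : nat) :
  (1 <= K)%nat -> Aplus_rep d f -> (forall n, (1 <= n < K)%nat -> d n = RtoC 0) ->
  tends (fun x => Cmult (npow_neg K (Copp (RtoC x))) (f (RtoC x))) (d K).
Proof.
  intros HK [Hs Hr] Hlow.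
  set (c := ln (INR (S K)) - ln (INR K)).
  assert (Hc : 0 < c) by (pose proof (ln_INR_lt K (S K) ltac:(lia)); unfold c; lra).
  apply tends_le with (fun x => l1_norm d * exp (- x * c)); [| now apply is_lim_scal_exp].
  intros x Hx.
  assert (H1 : Cmod (Cminus (f (RtoC x)) (Cmult (d K) (npow_neg K (RtoC x))))
               <= exp (- x * ln (INR (S K))) * l1_norm d).
  (* The [K]-th term is removed by adding the monomial with coefficient -d_K. *)
  { assert (E := is_cseries_plus _ _ _ _ (Hr (RtoC x) Hx)
       (represents_single (in_half_plane 0) K (Copp (d K)) HK (RtoC x) Hx)).
    replace (Cminus (f (RtoC x)) (Cmult (d K) (npow_neg K (RtoC x)))) with
      (Cplus (f (RtoC x)) (Cmult (Copp (d K)) (npow_neg K (RtoC x)))) by ring.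
    refine (Cmod_cseries_le_scal _ _ _ (fun k => Cmod (d (S k))) E _ Hs).
    intros k; unfold ds_term, single.
    destruct (Nat.eqb_spec (S k) K) as [<- | Hne].
    - match goal with |- Cmod ?z <= _ => replace z with (RtoC 0) by ring end.
      rewrite Cmod_0; apply Rmult_le_pos; [apply Rlt_le, exp_pos | apply Cmod_ge_0].
    - rewrite Cmult_0_l, Cplus_0_r, Cmod_mult, Rmult_comm.
      destruct (Nat.lt_ge_cases (S k) K) as [Hlt | Hge].
      + rewrite Hlow by lia; rewrite Cmod_0; rewrite !Rmult_0_r; apply Rle_refl.
      + apply Rmult_le_compat_r; [apply Cmod_ge_0 |].
        rewrite Cmod_npow_neg; apply exp_le_compat; simpl Re.
        assert (ln (INR (S K)) <= ln (INR (S k))).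
        { destruct (Nat.eq_dec (S K) (S k)) as [-> | ]; [apply Rle_refl |].
          apply Rlt_le, ln_INR_lt; lia. }
        nra. }
  replace (Cminus (Cmult (npow_neg K (Copp (RtoC x))) (f (RtoC x))) (d K)) with
    (Cmult (npow_neg K (Copp (RtoC x)))
       (Cminus (f (RtoC x)) (Cmult (d K) (npow_neg K (RtoC x))))).
  2: { transitivity (Cminus (Cmult (npow_neg K (Copp (RtoC x))) (f (RtoC x)))
         (Cmult (d K) (Cmult (npow_neg K (Copp (RtoC x))) (npow_neg K (RtoC x))))); [ring |].
       rewrite npow_neg_opp; ring. }
  rewrite Cmod_mult, Cmod_npow_neg.
  replace (l1_norm d * exp (- x * c)) with
    (exp (x * ln (INR K)) * (exp (- x * ln (INR (S K))) * l1_norm d)).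
  2: { rewrite <- Rmult_assoc, <- exp_plus, Rmult_comm; do 2 f_equal; unfold c; ring. }
  replace (- Re (Copp (RtoC x))) with x by (simpl; ring).
  apply Rmult_le_compat_l; [apply Rlt_le, exp_pos | exact H1].
Qed.

(** Conversely, a finite limit of K^x f(x) determines the beginning of the series. For n < K, n^x
    f(x) is (n/K)^x times a convergent quantity, hence tends to 0, so strong induction and
    [lead_coeff_lim] give d_n = 0. Coefficients of products can thus be read off from limits. *)
Lemma lead_coeff_unique (d : nat -> C) (f : C -> C) (K : nat) (l : C) :
  (1 <= K)%nat -> Aplus_rep d f ->
  tends (fun x => Cmult (npow_neg K (Copp (RtoC x))) (f (RtoC x))) l ->
  (forall n, (1 <= n < K)%nat -> d n = RtoC 0) /\ d K = l.
Proof.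
  intros HK Hd Hl.
  assert (Hlow : forall n, (1 <= n < K)%nat -> d n = RtoC 0).
  { induction n as [n IH] using (well_founded_induction Wf_nat.lt_wf); intros Hn.
    assert (H1 := lead_coeff_lim d f n ltac:(lia) Hd ltac:(intros; apply IH; lia)).
    assert (H2 : tends (fun x => npow_neg n (Copp (RtoC x)) * npow_neg K (RtoC x))%C (RtoC 0)).
    { pose proof (ln_INR_lt n K Hn) as Hlt.
      apply tends_le with (fun x => 1 * exp (- x * (ln (INR K) - ln (INR n))));
        [| apply is_lim_scal_exp; lra].
      intros x _.
      match goal with |- Cmod (Cminus ?a _) <= _ => replace (Cminus a (RtoC 0)) with a by ring end.
      rewrite Cmod_mult, !Cmod_npow_neg, <- exp_plus, Rmult_1_l; simpl.
      right; f_equal; ring. }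
    apply (tends_unique _ _ _ H1).
    replace (RtoC 0) with (Cmult (RtoC 0) l) by ring.
    apply tends_ext with (2 := tends_mult _ _ _ _ H2 Hl).
    intros x _.
    transitivity (Cmult (Cmult (npow_neg K (Copp (RtoC x))) (npow_neg K (RtoC x)))
       (Cmult (npow_neg n (Copp (RtoC x))) (f (RtoC x)))); [ring |].
    rewrite npow_neg_opp; ring. }
  split; [exact Hlow |].
  exact (tends_unique _ _ _ (lead_coeff_lim d f K HK Hd Hlow) Hl).
Qed.

(** The difference of the two sequences represents the zero function, to which [lead_coeff_unique]
    applies with limit 0 at any index. *)
Lemma coeff_unique (a b : nat -> C) (f : C -> C) (n : nat) :
  Aplus_rep a f -> Aplus_rep b f -> (1 <= n)%nat -> a n = b n.
Proof.
  intros [Ha Ra] [Hb Rb] Hn.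
  assert (Hd : Aplus_rep (fun n => RtoC 1 * a n + RtoC (-1) * b n)%C
                 (fun s => RtoC 1 * f s + RtoC (-1) * f s)%C)
    by (split; [now apply abs_summable_lin | now apply represents_on_lin]).
  assert (T : tends (fun x => Cmult (npow_neg n (Copp (RtoC x)))
                (RtoC 1 * f (RtoC x) + RtoC (-1) * f (RtoC x))%C) (RtoC 0)).
  { apply tends_ext with (2 := tends_const (RtoC 0)); intros x _.
    replace (RtoC (-1)) with (Copp (RtoC 1)) by (rewrite <- RtoC_opp; reflexivity). ring. }
  destruct (lead_coeff_unique _ _ n _ Hn Hd T) as [_ E]; cbv beta in E.
  replace (a n) with (Cplus (RtoC 1 * a n + RtoC (-1) * b n)%C (b n))
    by (replace (RtoC (-1)) with (Copp (RtoC 1)) by (rewrite <- RtoC_opp; reflexivity); ring).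
  rewrite E; ring.
Qed.

(** * Reindexing a series along an increasing sequence of indices *)

(* The number of [k] with [sigma k < M], for increasing [sigma]. *)
Fixpoint count_below (sigma : nat -> nat) (M : nat) : nat :=
  match M with
  | O => O
  | S M' => if Nat.eqb (sigma (count_below sigma M')) M'
            then S (count_below sigma M') else count_below sigma M'
  end.

(* Extension by [z] of [h \o sigma^{-1}]; meant for increasing [sigma]. *)
Definition pushforward {V : Type} (z : V) (sigma : nat -> nat) (h : nat -> V) (i : nat) : V :=
  if Nat.eqb (sigma (count_below sigma i)) i then h (count_below sigma i) else z.

Definition increasing_seq (sigma : nat -> nat) : Prop := forall k, (sigma k < sigma (S k))%nat.

Lemma increasing_seq_lt (sigma : nat -> nat) (j k : nat) :
  increasing_seq sigma -> (j < k)%nat -> (sigma j < sigma k)%nat.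
Proof.
  intros Hs H; induction H as [|k H IH]; [apply Hs | pose proof (Hs k); lia].
Qed.

(** With monotonicity these two bounds determine the count, so that [count_below] inverts [sigma] on
    its range. *)
Lemma count_below_spec (sigma : nat -> nat) (M : nat) : increasing_seq sigma ->
  (forall j, (j < count_below sigma M)%nat -> (sigma j < M)%nat) /\
  (M <= sigma (count_below sigma M))%nat.
Proof.
  intros Hs; induction M as [|M [IH1 IH2]]; simpl; [split; lia |].
  destruct (Nat.eqb_spec (sigma (count_below sigma M)) M) as [E | E]; split.
  - intros j Hj; destruct (Nat.eq_dec j (count_below sigma M)) as [-> | Hne]; [lia |].
    pose proof (IH1 j ltac:(lia)); lia.
  - pose proof (Hs (count_below sigma M)); lia.
  - intros j Hj; pose proof (IH1 j Hj); lia.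
  - lia.
Qed.

Lemma count_below_at (sigma : nat -> nat) (k : nat) : increasing_seq sigma ->
  count_below sigma (sigma k) = k.
Proof.
  intros Hs; destruct (count_below_spec sigma (sigma k) Hs) as [H1 H2].
  destruct (Nat.lt_trichotomy (count_below sigma (sigma k)) k) as [H | [H | H]]; [| exact H |].
  - pose proof (increasing_seq_lt sigma _ _ Hs H); lia.
  - pose proof (H1 k H); lia.
Qed.

Lemma pushforward_at {V : Type} (z : V) (sigma : nat -> nat) (h : nat -> V) (k : nat) :
  increasing_seq sigma -> pushforward z sigma h (sigma k) = h k.
Proof.
  intros Hs; unfold pushforward; rewrite count_below_at by exact Hs.
  now rewrite Nat.eqb_refl.
Qed.

(** The sum on the left stops at index [M] included, hence the count below [S M]; a count of [S k]
    corresponds to [sum_n h k], which has k+1 terms. *)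
Lemma sum_n_pushforward {G : AbelianMonoid} (sigma : nat -> nat) (h : nat -> G) (M : nat) :
  sum_n (pushforward zero sigma h) M =
  match count_below sigma (S M) with O => zero | S k => sum_n h k end.
Proof.
  induction M as [|M IH].
  - rewrite sum_O; unfold pushforward; simpl.
    destruct (Nat.eqb (sigma 0%nat) 0); [now rewrite sum_O | reflexivity].
  - rewrite sum_Sn, IH.
    change (count_below sigma (S (S M))) with
      (if Nat.eqb (sigma (count_below sigma (S M))) (S M)
       then S (count_below sigma (S M)) else count_below sigma (S M)).
    unfold pushforward.
    destruct (Nat.eqb (sigma (count_below sigma (S M))) (S M)); [| apply plus_zero_r].
    destruct (count_below sigma (S M)) as [|k].
    + rewrite sum_O; apply plus_zero_l.
    + now rewrite sum_Sn.
Qed.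

(** Inserting zeros only repeats partial sums: those of the new series are partial sums of [h] at an
    index that tends to infinity. *)
Lemma is_series_pushforward {K : AbsRing} {V : NormedModule K}
  (sigma : nat -> nat) (h : nat -> V) (l : V) :
  increasing_seq sigma -> is_series h l -> is_series (pushforward zero sigma h) l.
Proof.
  intros Hs Hh.
  assert (Hbig : forall k M, (sigma k <= M)%nat -> (k < count_below sigma (S M))%nat).
  { intros k M HM; destruct (count_below_spec sigma (S M) Hs) as [_ H].
    destruct (Nat.lt_ge_cases k (count_below sigma (S M))) as [|H']; [assumption |].
    destruct (Nat.eq_dec (count_below sigma (S M)) k) as [E | E]; [rewrite E in H; lia |].
    pose proof (increasing_seq_lt sigma (count_below sigma (S M)) k Hs ltac:(lia)); lia. }
  apply filterlim_ext_loc with (fun M => sum_n h (pred (count_below sigma (S M)))).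
  - exists (sigma O); intros M HM; rewrite sum_n_pushforward.
    pose proof (Hbig O M HM); destruct (count_below sigma (S M)); [lia | reflexivity].
  - eapply filterlim_comp; [| exact Hh].
    intros P [N HN]; exists (sigma N); intros M HM; apply HN.
    pose proof (Hbig N M HM); lia.
Qed.

(** Here [sigma] acts on zero-based positions: the coefficient of index k+1 moves to index
    [S (sigma k)]. The value at 0 is a dummy. *)
Definition push_coeffs (sigma : nat -> nat) (a : nat -> C) (n : nat) : C :=
  match n with
  | O => RtoC 0
  | S i => pushforward (RtoC 0) sigma (fun k => a (S k)) i
  end.

Lemma push_coeffs_at (sigma : nat -> nat) (a : nat -> C) (k : nat) :
  increasing_seq sigma -> push_coeffs sigma a (S (sigma k)) = a (S k).
Proof. intros Hs; exact (pushforward_at _ sigma (fun k => a (S k)) k Hs). Qed.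

Lemma push_coeffs_norm (sigma : nat -> nat) (a : nat -> C) (l : R) :
  increasing_seq sigma -> is_series (fun k => Cmod (a (S k))) l ->
  is_series (fun k => Cmod (push_coeffs sigma a (S k))) l.
Proof.
  intros Hs H; generalize (is_series_pushforward sigma _ _ Hs H).
  apply is_series_ext; intros i; unfold push_coeffs, pushforward.
  destruct (Nat.eqb _ i); [reflexivity | symmetry; exact Cmod_0].
Qed.

Lemma push_coeffs_represents (U : C -> Prop) (sigma : nat -> nat) (a : nat -> C) (f : C -> C) :
  increasing_seq sigma ->
  (forall s, U s -> is_cseries (fun k => Cmult (a (S k)) (npow_neg (S (sigma k)) s)) (f s)) ->
  represents_on U (push_coeffs sigma a) f.
Proof.
  intros Hs H s HU; generalize (is_series_pushforward sigma _ _ Hs (H s HU)).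
  apply is_cseries_ext; intros i; unfold ds_term, push_coeffs, pushforward.
  destruct (Nat.eqb_spec (sigma (count_below sigma i)) i) as [E | E]; [now rewrite E |].
  symmetry; apply Cmult_0_l.
Qed.

(** Multiplication by A^{-s} sends n^{-s} to (An)^{-s}, so it is the reindexing n -> An, zero-based
    in [sigma]. *)
Lemma dilate_rep (A : nat) (a : nat -> C) (f : C -> C) : (1 <= A)%nat -> Aplus_rep a f ->
  exists b, Aplus_rep b (fun s => Cmult (npow_neg A s) (f s)) /\
    forall n, (1 <= n)%nat -> b (A * n)%nat = a n.
Proof.
  intros HA [[l Ha] Hr].
  set (sigma := fun k => pred (A * S k)).
  assert (HS : forall k, S (sigma k) = (A * S k)%nat) by (intros k; unfold sigma; lia).
  assert (Hs : increasing_seq sigma) by (intros k; unfold sigma; nia).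
  exists (push_coeffs sigma a); split; [split |].
  - exists l; now apply push_coeffs_norm.
  - apply push_coeffs_represents; [exact Hs |]; intros s HU.
    generalize (is_cseries_scal (npow_neg A s) _ _ (Hr s HU)).
    apply is_cseries_ext; intros k; unfold ds_term.
    rewrite HS, npow_neg_mult by lia; ring.
  - intros n Hn; replace n with (S (pred n)) by lia.
    rewrite <- HS; now apply push_coeffs_at.
Qed.

(** * Limits of n^{-g(x)} and of Dirichlet series as x -> +oo *)

Lemma tends_Re_Im (g : R -> C) (l : C) :
  tends g l <-> is_lim (fun x => Re (g x)) p_infty (Re l) /\
                is_lim (fun x => Im (g x)) p_infty (Im l).
Proof.
  assert (Hshift : forall (h : R -> R) (y : R),
    is_lim h p_infty y <-> is_lim (fun x => Rabs (h x - y)) p_infty 0).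
  { intros h y; split; intros H; apply is_lim_spec; apply is_lim_spec in H;
      intros eps; destruct (H eps) as [M HM]; exists M; intros x Hx; specialize (HM x Hx);
      cbv beta in HM |- *;
      [rewrite Rminus_0_r, Rabs_Rabsolu | rewrite Rminus_0_r, Rabs_Rabsolu in HM]; exact HM. }
  rewrite (Hshift (fun x => Re (g x))), (Hshift (fun x => Im (g x))); split.
  - intros H; split;
      (apply is_lim_le_le_loc with (fun _ => 0) (fun x => Cmod (Cminus (g x) l));
       [| apply is_lim_const | exact H]); exists 0; intros x _; split; try apply Rabs_pos.
    + exact (re_le_Cmod (Cminus (g x) l)).
    + eapply Rle_trans; [| apply Rmax_Cmod]; apply Rmax_r.
  - intros [H1 H2]; unfold tends.
    apply is_lim_le_le_loc with (fun _ => 0)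
      (fun x => Rabs (Re (g x) - Re l) + Rabs (Im (g x) - Im l)); [| apply is_lim_const |].
    + exists 0; intros x _; split; [apply Cmod_ge_0 |].
      apply Rsqr_incr_0_var; [| pose proof (Rabs_pos (Re (g x) - Re l));
        pose proof (Rabs_pos (Im (g x) - Im l)); lra].
      assert (E := Cmod2_alt (Cminus (g x) l)).
      assert (Er : Re (Cminus (g x) l) = Re (g x) - Re l) by reflexivity.
      assert (Ei : Im (Cminus (g x) l) = Im (g x) - Im l) by reflexivity.
      rewrite Er, Ei, <- (pow2_abs (Re (g x) - Re l)), <- (pow2_abs (Im (g x) - Im l)) in E.
      pose proof (Rabs_pos (Re (g x) - Re l)); pose proof (Rabs_pos (Im (g x) - Im l)).
      unfold Rsqr; nra.
    + rewrite <- (Rplus_0_r 0); apply is_lim_plus'; assumption.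
Qed.

Lemma tends_npow_neg (n : nat) (g : R -> C) (l : C) :
  tends g l -> tends (fun x => npow_neg n (g x)) (npow_neg n l).
Proof.
  intros H; apply tends_Re_Im in H; destruct H as [Hre Him].
  set (L := ln (INR n)).
  assert (He : is_lim (fun x => exp (- Re (g x) * L)) p_infty (exp (- Re l * L))).
  { apply (is_lim_comp_continuous _ (fun y => exp (- y * L)) _ _ Hre).
    apply (ex_derive_continuous (V := R_NormedModule)); auto_derive; exact I. }
  assert (Hc : is_lim (fun x => cos (Im (g x) * L)) p_infty (cos (Im l * L))).
  { apply (is_lim_comp_continuous _ (fun y => cos (y * L)) _ _ Him).
    apply (ex_derive_continuous (V := R_NormedModule)); auto_derive; exact I. }
  assert (Hs : is_lim (fun x => sin (Im (g x) * L)) p_infty (sin (Im l * L))).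
  { apply (is_lim_comp_continuous _ (fun y => sin (y * L)) _ _ Him).
    apply (ex_derive_continuous (V := R_NormedModule)); auto_derive; exact I. }
  apply tends_Re_Im; split.
  - exact (is_lim_mult _ _ _ _ _ He Hc I).
  - exact (is_lim_opp _ _ _ (is_lim_mult _ _ _ _ _ He Hs I)).
Qed.

(** The terms are y^{-2} with y = k+1. Since y >= 1, they are at most 2/(y(y+1)) = 2(1/y - 1/(y+1)),
    which telescopes. *)
Lemma ex_series_inv_sq : ex_series (fun k => exp (- 2 * ln (INR (S k)))).
Proof.
  apply (@ex_series_le R_AbsRing R_CompleteNormedModule) with
    (fun k => 2 * (/ INR (S k) - / INR (S (S k)))).
  - intros k; change (norm ?x) with (Rabs x).
    rewrite Rabs_pos_eq by apply Rlt_le, exp_pos.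
    set (y := INR (S k)).
    assert (Hy : 1 <= y) by (unfold y; rewrite S_INR; pose proof (pos_INR k); lra).
    replace (INR (S (S k))) with (y + 1) by (unfold y; rewrite (S_INR (S k)); reflexivity).
    replace (- 2 * ln y) with (- (ln y + ln y)) by ring.
    rewrite exp_Ropp, exp_plus, exp_ln by lra.
    replace (2 * (/ y - / (y + 1))) with (/ (y * y) * (2 * y / (y + 1))) by (field; lra).
    rewrite <- (Rmult_1_r (/ (y * y))) at 1.
    apply Rmult_le_compat_l; [apply Rlt_le, Rinv_0_lt_compat; nra |].
    apply Rmult_le_reg_r with (y + 1); [lra |].
    replace (2 * y / (y + 1) * (y + 1)) with (2 * y) by (field; lra); lra.
  - apply ex_series_Rscal; exists 1.
    assert (E : forall n, sum_n (fun k => / INR (S k) - / INR (S (S k))) n = 1 - / INR (S (S n))).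
    { induction n as [|n IH].
      - rewrite sum_O; simpl INR at 1; rewrite Rinv_1; reflexivity.
      - rewrite sum_Sn, IH.
        change (1 - / INR (S (S n)) + (/ INR (S (S n)) - / INR (S (S (S n)))) = 1 - / INR (S (S (S n)))); ring. }
    change (is_lim_seq (sum_n (fun k => / INR (S k) - / INR (S (S k)))) 1).
    apply (is_lim_seq_ext (fun n => 1 - / INR (S (S n)))); [intros n; now rewrite E |].
    replace (Finite 1) with (Finite (1 - 0)) by (f_equal; ring).
    apply is_lim_seq_minus'; [apply is_lim_seq_const |].
    apply (is_lim_seq_incr_1 (fun n => / INR (S n))), (is_lim_seq_incr_1 (fun n => / INR n)).
    assert (H := is_lim_seq_inv _ _ is_lim_seq_INR ltac:(discriminate)); exact H.
Qed.

Lemma cseries_terms_bounded (u : nat -> C) (l : C) : is_cseries u l ->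
  exists B, forall k, Cmod (u k) <= B.
Proof.
  intros H.
  destruct (filterlim_bounded (K := C_AbsRing) (V := C_NormedModule) (sum_n u) (ex_intro _ l H))
    as [M HM].
  exists (M + M); intros [|k].
  - assert (E := HM O); rewrite sum_O in E; change (Cmod (u O) <= M) in E.
    pose proof (Cmod_ge_0 (u O)); lra.
  - assert (E1 := HM k); assert (E2 := HM (S k)); rewrite sum_Sn in E2.
    change (Cmod (@sum_n C_NormedModule u k) <= M) in E1.
    change (Cmod (Cplus (@sum_n C_NormedModule u k) (u (S k))) <= M) in E2.
    set (S0 := @sum_n C_NormedModule u k) in *.
    replace (u (S k)) with (Cplus (Cplus S0 (u (S k))) (Copp S0)) by ring.
    eapply Rle_trans; [apply Cmod_triangle |]; rewrite Cmod_opp; lra.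
Qed.

(** Convergence alone does not place [g] in the scope of [lead_coeff_lim]. Boundedness of the terms
    at one point [X] suffices: moving 2 further to the right adds a factor n^{-2}, which makes the
    coefficients summable. *)
Lemma dirichlet_series_limit (c : nat -> C) (g : C -> C) (sigma : R) :
  represents_on (in_half_plane sigma) c g -> exists l, tends (fun x => g (RtoC x)) l.
Proof.
  intros Hg.
  (* Shifting [s] by [X + 2] makes the series absolutely convergent. *)
  set (X := Rabs sigma + 1).
  assert (HX : sigma < X) by (pose proof (Rle_abs sigma); unfold X; lra).
  destruct (cseries_terms_bounded _ _ (Hg (RtoC X) HX)) as [B HB].
  set (c' := fun n => Cmult (c n) (npow_neg n (RtoC (X + 2)))).
  assert (Hc' : Aplus_rep c' (fun s => g (Cplus s (RtoC (X + 2))))).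
  { split.
    - apply (@ex_series_le R_AbsRing R_CompleteNormedModule) with
        (fun k => B * exp (- 2 * ln (INR (S k)))); [| apply ex_series_Rscal, ex_series_inv_sq].
      intros k; change (norm ?x) with (Rabs x).
      rewrite Rabs_pos_eq by apply Cmod_ge_0.
      unfold c'; rewrite RtoC_plus, npow_neg_plus, Cmult_assoc, Cmod_mult.
      rewrite (Cmod_npow_neg _ (RtoC 2)); simpl Re.
      apply Rmult_le_compat_r; [apply Rlt_le, exp_pos | apply HB].
    - intros s Hs; unfold in_half_plane in Hs.
      assert (Hs' : in_half_plane sigma (Cplus s (RtoC (X + 2)))).
      { unfold in_half_plane in *; unfold Re in *; simpl; lra. }
      generalize (Hg _ Hs'); apply is_cseries_ext; intros k; unfold ds_term, c'.
      rewrite npow_neg_plus; ring. }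
  exists (c' 1%nat).
  assert (E := lead_coeff_lim c' _ 1 ltac:(lia) Hc' ltac:(intros; lia)).
  assert (E' : tends (fun x => g (RtoC (x + (X + 2)))) (c' 1%nat)).
  { apply tends_ext with (2 := E); intros x _; rewrite npow_neg_1, Cmult_1_l, (RtoC_plus x); reflexivity. }
  (* The translation by X + 2 is undone by substituting x - (X + 2), which still tends to +oo. *)
  apply (is_lim_ext (fun x => Cmod (Cminus (g (RtoC ((1 * x + - (X + 2)) + (X + 2)))) (c' 1%nat)))).
  - intros x; do 4 f_equal; ring.
  - apply (is_lim_comp_lin (fun x => Cmod (Cminus (g (RtoC (x + (X + 2)))) (c' 1%nat))) 1); [| lra].
    replace (Rbar_plus (Rbar_mult 1 p_infty) (- (X + 2))) with p_infty; [exact E' |].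
    unfold Rbar_mult, Rbar_mult'; destruct (Rle_dec 0 1) as [H | H]; [| lra].
    destruct (Rle_lt_or_eq_dec 0 1 H) as [H' | H']; [reflexivity | lra].
Qed.

(** * Uniqueness of sums and equality in the triangle inequality *)

Lemma is_cseries_unique (u : nat -> C) (l m : C) : is_cseries u l -> is_cseries u m -> l = m.
Proof.
  intros Hl Hm.
  exact (filterlim_locally_unique (K := C_AbsRing) (V := C_NormedModule) (F := eventually)
           (sum_n u) l m Hl Hm).
Qed.

Lemma represents_on_ext (U : C -> Prop) (a : nat -> C) (f g : C -> C) :
  (forall s, U s -> f s = g s) -> represents_on U a f -> represents_on U a g.
Proof. intros E H s Hs; rewrite <- E by exact Hs; now apply H. Qed.

Lemma Series_eq_0 (v : nat -> R) : (forall k, 0 <= v k) -> is_series v 0 -> forall k, v k = 0.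
Proof.
  intros Hv H k.
  assert (E := is_series_unique _ _ (@is_series_single R_AbsRing R_NormedModule k (v k))).
  change (Series (fun j => if Nat.eqb j k then v k else 0) = v k) in E.
  assert (L : Series (fun j => if Nat.eqb j k then v k else 0) <= Series v).
  { apply Series_le; [| now exists 0].
    intros j; destruct (Nat.eqb_spec j k) as [-> |]; split; auto; apply Rle_refl. }
  rewrite E, (is_series_unique _ _ H) in L.
  apply Rle_antisym; auto.
Qed.

(** By the parallelogram law 2(|x| + |y|)^2 = 2|x|^2 + 2|y|^2, hence |x||y| = 0. *)
Lemma Cmod_triangle_eq_opp (x y : C) :
  Cmod (Cplus x y) = Cmod x + Cmod y -> Cmod (Cminus x y) = Cmod x + Cmod y ->
  x = RtoC 0 \/ y = RtoC 0.
Proof.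
  intros H1 H2.
  assert (E1 := Cmod2_alt (Cplus x y)); assert (E2 := Cmod2_alt (Cminus x y)).
  assert (E3 := Cmod2_alt x); assert (E4 := Cmod2_alt y).
  rewrite H1 in E1; rewrite H2 in E2; destruct x as [x1 x2], y as [y1 y2]; simpl in E1, E2, E3, E4.
  assert (P : Cmod (x1, x2) * Cmod (y1, y2) = 0) by nra.
  destruct (Rmult_integral _ _ P); [left | right]; now apply Cmod_eq_0.
Qed.

(** * Isometric composition operators *)

Lemma isometry_norm (phi : C -> C) (n : nat) (b : nat -> C) : Cphi_isometry phi ->
  (1 <= n)%nat -> Aplus_rep b (fun s => npow_neg n (phi s)) -> l1_norm b = 1.
Proof.
  intros Hiso Hn [Hb Hr].
  (* The isometry is tested on n^{-s}; the factor 1 matches the form of [represents_single]. *)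
  rewrite (Hiso (fun s => Cmult (RtoC 1) (npow_neg n s)) (single n (RtoC 1)) b); auto.
  - transitivity (Cmod (RtoC 1)); [apply is_series_unique, single_norm, Hn | exact Cmod_1].
  - split; [now apply abs_summable_single | now apply represents_single].
  - apply represents_on_ext with (2 := Hr); intros s _; ring.
Qed.

Lemma isometry_norm_pair (phi : C -> C) (n k : nat) (lam : C) (b d : nat -> C) :
  Cphi_isometry phi -> (1 <= n)%nat -> (1 <= k)%nat -> n <> k -> Cmod lam = 1 ->
  Aplus_rep b (fun s => npow_neg n (phi s)) -> Aplus_rep d (fun s => npow_neg k (phi s)) ->
  l1_norm (fun j => Cplus (Cmult (RtoC 1) (b j)) (Cmult lam (d j))) = 2.
Proof.
  intros Hiso Hn Hk Hnk Hlam [Hb Rb] [Hd Rd].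
  set (a := fun j => Cplus (Cmult (RtoC 1) (single n (RtoC 1) j)) (Cmult lam (single k (RtoC 1) j))).
  set (f := fun s => Cplus (Cmult (RtoC 1) (Cmult (RtoC 1) (npow_neg n s)))
                       (Cmult lam (Cmult (RtoC 1) (npow_neg k s)))).
  rewrite (Hiso f a).
  - unfold l1_norm; apply is_series_unique.
    replace 2 with (Cmod (RtoC 1) + Cmod (RtoC 1)) by (rewrite Cmod_1; ring).
    generalize (is_series_plus _ _ _ _ (single_norm n (RtoC 1) Hn) (single_norm k (RtoC 1) Hk)).
    apply is_series_ext; intros j; unfold a, single.
    match goal with |- plus ?x ?y = ?z => change (x + y = z) end.
    destruct (Nat.eqb_spec (S j) n), (Nat.eqb_spec (S j) k); try lia;
      rewrite ?Cmult_0_r, ?Cplus_0_l, ?Cplus_0_r, ?Cmult_1_r, ?Cmod_1, ?Cmod_0, ?Hlam; ring.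
  - split; [apply abs_summable_lin; now apply abs_summable_single
           | apply represents_on_lin; now apply represents_single].
  - now apply abs_summable_lin.
  - apply represents_on_ext with (2 := represents_on_lin _ (RtoC 1) lam _ _ _ _ Rb Rd).
    intros s _; unfold f; ring.
Qed.

(** For |lam| = 1 the defects |b_i| + |d_i| - |b_i + lam d_i| are nonnegative and sum to 1 + 1 - 2 =
    0, so each vanishes. The values lam = 1 and lam = -1 then meet the hypotheses of
    [Cmod_triangle_eq_opp]. *)
Lemma isometry_disjoint (phi : C -> C) (n k : nat) (b d : nat -> C) (j : nat) :
  Cphi_isometry phi -> (1 <= n)%nat -> (1 <= k)%nat -> n <> k ->
  Aplus_rep b (fun s => npow_neg n (phi s)) -> Aplus_rep d (fun s => npow_neg k (phi s)) ->
  (1 <= j)%nat -> b j = RtoC 0 \/ d j = RtoC 0.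
Proof.
  intros Hiso Hn Hk Hnk Hb Hd Hj.
  assert (H : forall lam, Cmod lam = 1 ->
    Cmod (Cplus (Cmult (RtoC 1) (b j)) (Cmult lam (d j))) = Cmod (b j) + Cmod (d j)).
  { intros lam Hlam.
    assert (H2 := isometry_norm_pair phi n k lam b d Hiso Hn Hk Hnk Hlam Hb Hd).
    assert (Nb := isometry_norm phi n b Hiso Hn Hb).
    assert (Nd := isometry_norm phi k d Hiso Hk Hd).
    destruct Hb as [Sb _], Hd as [Sd _].
    assert (Ss := abs_summable_lin (RtoC 1) lam b d Sb Sd).
    apply Series_correct in Sb, Sd, Ss.
    fold (l1_norm b) in Sb; fold (l1_norm d) in Sd.
    change (Series _) with (l1_norm (fun j => Cplus (Cmult (RtoC 1) (b j)) (Cmult lam (d j)))) in Ss.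
    rewrite Nb in Sb; rewrite Nd in Sd; rewrite H2 in Ss.
    set (v := fun i => Cmod (b (S i)) + Cmod (d (S i))
      - Cmod (Cplus (Cmult (RtoC 1) (b (S i))) (Cmult lam (d (S i))))).
    assert (D : is_series v 0).
    { replace 0 with (1 + 1 - 2) by ring.
      exact (is_series_minus _ _ _ _ (is_series_plus _ _ _ _ Sb Sd) Ss). }
    assert (Z : v (pred j) = 0).
    { apply Series_eq_0; [| exact D]; intros i; unfold v.
      assert (T := Cmod_triangle (Cmult (RtoC 1) (b (S i))) (Cmult lam (d (S i)))).
      rewrite !Cmod_mult, Hlam, Cmod_1 in T; lra. }
    unfold v in Z; replace (S (pred j)) with j in Z by lia.
    lra. }
  apply Cmod_triangle_eq_opp.
  - rewrite <- (H (RtoC 1) Cmod_1); f_equal; ring.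
  - rewrite <- (H (Copp (RtoC 1)) Cmod_m1); f_equal; ring.
Qed.

(** On the real axis n^{-phi(x)} = (n^{c0})^{-x} n^{-varphi(x)}, and the last factor tends to
    n^{-l}; [lead_coeff_unique] turns this limit into coefficients. *)
Lemma lead_coeff_npow (phi varphi : C -> C) (c0 : nat) (l : C) (n : nat) (b : nat -> C) :
  (forall s, in_half_plane 0 s -> phi s = Cplus (Cmult (RtoC (INR c0)) s) (varphi s)) ->
  tends (fun x => varphi (RtoC x)) l -> (1 <= n)%nat ->
  Aplus_rep b (fun s => npow_neg n (phi s)) ->
  (forall i, (1 <= i < n ^ c0)%nat -> b i = RtoC 0) /\ b (n ^ c0)%nat = npow_neg n l.
Proof.
  intros Hform Hl Hn Hb.
  apply lead_coeff_unique with (2 := Hb); [now apply pow_ge_1 |].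
  apply tends_ext with (2 := tends_npow_neg n _ _ Hl); intros x Hx.
  rewrite (Hform (RtoC x) Hx), npow_neg_plus, npow_neg_INR_mult, !npow_neg_pow, Cmult_assoc by exact Hn.
  rewrite <- Cpow_mult_l, npow_neg_opp, Cpow_1_l; ring.
Qed.

(* Induction on [i] through [u^q w^{i+1} = u^{q+1} w^i - alpha A^{-s} u^q w^i]: multiplying
   by [A^{-s}] only shifts indices, so no Dirichlet convolution is needed. *)
Lemma coeff_power_product_eq_0 (u : C -> C) (A c0 m : nat) (alpha : C) (w : C -> C) :
  (1 <= A)%nat -> (1 <= m)%nat ->
  (forall s, in_half_plane 0 s -> w s = Cminus (u s) (Cmult alpha (npow_neg A s))) ->
  (forall q, (c0 <= q)%nat -> exists e, Aplus_rep e (fun s => Cpow (u s) q) /\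
      e (A ^ (q - c0) * m ^ c0)%nat = RtoC 0) ->
  forall i q, (c0 <= q)%nat ->
    exists e, Aplus_rep e (fun s => Cmult (Cpow (u s) q) (Cpow (w s) i)) /\
      e (A ^ (q + i - c0) * m ^ c0)%nat = RtoC 0.
Proof.
  intros HA Hm Hw Hbase i.
  induction i as [|i IH]; intros q Hq.
  - destruct (Hbase q Hq) as [e [[He Re] E]]; exists e; split; [split; [exact He |] |].
    + apply represents_on_ext with (2 := Re); intros s _; simpl; ring.
    + rewrite Nat.add_0_r; exact E.
  - destruct (IH (S q) ltac:(lia)) as [e1 [[S1 R1] E1]].
    destruct (IH q Hq) as [e2 [H2 E2]].
    destruct (dilate_rep A e2 _ HA H2) as [e3 [[S3 R3] E3]].
    exists (fun k => Cplus (Cmult (RtoC 1) (e1 k)) (Cmult (Copp alpha) (e3 k))).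
    split; [split |].
    + now apply abs_summable_lin.
    + apply represents_on_ext with (2 := represents_on_lin _ (RtoC 1) (Copp alpha) _ _ _ _ R1 R3).
      intros s Hs; rewrite !Cpow_S, (Hw s Hs); ring.
    + replace (S q + i - c0)%nat with (q + S i - c0)%nat in E1 by lia.
      rewrite E1.
      (* The current index is A times the one where [e2] vanishes, so [E3] applies. The hypothesis
         c0 <= q keeps the truncated subtraction exact. *)
      replace (A ^ (q + S i - c0) * m ^ c0)%nat with (A * (A ^ (q + i - c0) * m ^ c0))%nat.
      * rewrite E3, E2; [ring |].
        assert (H : (1 <= A ^ (q + i - c0))%nat) by now apply pow_ge_1.
        assert (H' : (1 <= m ^ c0)%nat) by now apply pow_ge_1.
        nia.
      * replace (q + S i - c0)%nat with (S (q + i - c0)) by lia.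
        rewrite Nat.pow_succ_r'; ring.
Qed.

Lemma isometry_monomial (phi varphi : C -> C) (c0 : nat) (l : C) (n : nat) (b : nat -> C) :
  (forall s, in_half_plane 0 s -> phi s = Cplus (Cmult (RtoC (INR c0)) s) (varphi s)) ->
  tends (fun x => varphi (RtoC x)) l -> Cphi_isometry phi ->
  (forall k, (1 <= k)%nat -> exists d, Aplus_rep d (fun s => npow_neg k (phi s))) ->
  (2 <= n)%nat -> Aplus_rep b (fun s => npow_neg n (phi s)) ->
  forall j, (1 <= j)%nat -> j <> (n ^ c0)%nat -> b j = RtoC 0.
Proof.
  intros Hform Hl Hiso Hex Hn Hb.
  set (A := (n ^ c0)%nat); set (alpha := npow_neg n l).
  assert (HA : (1 <= A)%nat) by (apply pow_ge_1; lia).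
  destruct (lead_coeff_npow phi varphi c0 l n b Hform Hl ltac:(lia) Hb) as [Hlow HbA].
  fold A in Hlow, HbA; fold alpha in HbA.
  (* Strong induction makes m the least index other than A with a nonzero coefficient, so b_m is the
     leading coefficient of w. *)
  induction j as [m IH] using (well_founded_induction Wf_nat.lt_wf); intros Hm HmA.
  apply NNPP; intros Hbm.
  set (w := fun s => Cminus (npow_neg n (phi s)) (Cmult alpha (npow_neg A s))).
  set (dw := fun k => Cplus (Cmult (RtoC 1) (b k)) (Cmult (RtoC 1) (single A (Copp alpha) k))).
  assert (Hdw : Aplus_rep dw w).
  { destruct Hb as [Sb Rb]; split.
    - apply abs_summable_lin; [exact Sb | now apply abs_summable_single].
    - apply represents_on_ext with (2 := represents_on_lin _ (RtoC 1) (RtoC 1) _ _ _ _ Rb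
        (represents_single _ A (Copp alpha) HA)).
      intros s _; unfold w; ring. }
  assert (Lw : tends (fun x => Cmult (npow_neg m (Copp (RtoC x))) (w (RtoC x))) (b m)).
  { replace (b m) with (dw m).
    - apply lead_coeff_lim; [exact Hm | exact Hdw |].
      intros i Hi; unfold dw, single; destruct (Nat.eqb_spec i A) as [-> | Hi'].
      + rewrite HbA; ring.
      + rewrite IH by lia; ring.
    - unfold dw, single; destruct (Nat.eqb_spec m A); [contradiction | ring]. }
  assert (Lu := lead_coeff_lim b _ A HA Hb Hlow).
  rewrite HbA in Lu.
  destruct (coeff_power_product_eq_0 (fun s => npow_neg n (phi s)) A c0 m alpha w HA Hm
              (fun s _ => eq_refl)) with (i := c0) (q := c0) as [e [He Ee]].
  - intros q Hq.
    destruct (Hex (n ^ q)%nat ltac:(apply pow_ge_1; lia)) as [e He].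
    (* The exponent c0 on w makes A^{q-c0} m^{c0} a perfect c0-th power, equal to N^{c0}. At that
       index N^{-phi} has its nonzero leading coefficient, so the coefficient of (n^q)^{-phi} must
       vanish there. *)
    set (N := (n ^ (q - c0) * m)%nat).
    assert (Hp : (1 <= n ^ (q - c0))%nat) by (apply pow_ge_1; lia).
    assert (HN : (1 <= N)%nat) by (unfold N; nia).
    destruct (Hex N HN) as [d Hd].
    exists e; split.
    + destruct He as [Se Re]; split; [exact Se |].
      apply represents_on_ext with (2 := Re); intros s _; apply npow_neg_pow; lia.
    + replace (A ^ (q - c0) * m ^ c0)%nat with (N ^ c0)%nat.
      2: { unfold N, A; rewrite Nat.pow_mul_l, <- !Nat.pow_mul_r; do 2 f_equal; ring. }
      destruct (isometry_disjoint phi (n ^ q) N e d (N ^ c0) Hiso) as [E | E]; auto.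
      * apply pow_ge_1; lia.
      (* Disjointness requires n^q and N to differ: since n^q = n^{q-c0} A, equality would give m =
         A. *)
      * intros E; apply HmA.
        replace (n ^ q)%nat with (n ^ (q - c0) * A)%nat in E.
        -- unfold N in E; symmetry; apply (proj1 (Nat.mul_cancel_l _ _ (n ^ (q - c0)) ltac:(lia)) E).
        -- unfold A; rewrite <- Nat.pow_add_r; f_equal; lia.
      * now apply pow_ge_1.
      * destruct (lead_coeff_npow phi varphi c0 l N d Hform Hl HN Hd) as [_ E'].
        rewrite E in E'; symmetry in E'; contradiction (npow_neg_neq_0 N l E').
  - lia.
  - replace (c0 + c0 - c0)%nat with c0 in Ee by lia.
    rewrite <- Nat.pow_mul_l in Ee.
    assert (HAm : (1 <= A * m)%nat) by nia.
    (* The product of the leading limits of u and w gives (alpha b_m)^{c0} at this index, against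
       the zero in [Ee]. *)
    destruct (lead_coeff_unique e _ ((A * m) ^ c0) (Cpow (Cmult alpha (b m)) c0)
      ltac:(now apply pow_ge_1) He) as [_ E].
    + apply tends_ext with (2 := tends_pow _ _ c0 (tends_mult _ _ _ _ Lu Lw)); intros x _.
      rewrite npow_neg_pow, npow_neg_mult, !Cpow_mult_l by lia; ring.
    + rewrite Ee in E; symmetry in E; apply (Cpow_nz (Cmult alpha (b m)) c0) in E; [exact E |].
      apply Cmult_neq_0; [apply npow_neg_neq_0 | exact Hbm].
Qed.

(** * Determination of z by the values n^{-z} *)

(** A single n fixes z only modulo 2 pi i / ln n; letting n grow removes this ambiguity. *)
Lemma npow_neg_inj (z : C) : (forall n, (2 <= n)%nat -> npow_neg n z = RtoC 1) -> z = RtoC 0.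
Proof.
  intros H.
  assert (Hre : Re z = 0).
  { assert (E := Cmod_npow_neg 2 z); rewrite H, Cmod_1 in E by lia.
    rewrite <- exp_0 in E; apply exp_inv in E.
    assert (0 < ln (INR 2)) by (rewrite <- ln_1; apply ln_increasing; simpl; lra). nra. }
  set (t := Im z).
  assert (Hcs : forall n, (2 <= n)%nat -> cos (t * ln (INR n)) = 1 /\ sin (t * ln (INR n)) = 0).
  { intros n Hn; assert (E := H n Hn); unfold npow_neg in E; rewrite Hre in E.
    rewrite Ropp_0, Rmult_0_l, exp_0 in E; injection E; intros E1 E2; split; unfold t; lra. }
  apply C_ext; [exact Hre | change (t = 0)].
  (* [t ln n] is a multiple of 2 pi for all [n >= 2], while [t (ln (n+1) - ln n) -> 0]. *)
  destruct (INR_unbounded (Rabs t + 2)) as [n Hn].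
  pose proof (Rabs_pos t) as Ht.
  assert (Hn2 : (2 <= n)%nat) by (apply INR_le; simpl; lra).
  set (r := ln (INR (S n)) - ln (INR n)).
  assert (Hr : 0 < r) by (pose proof (ln_INR_lt n (S n) ltac:(lia)); unfold r; lra).
  assert (Hr' : r <= / INR n).
  { unfold r; rewrite <- ln_div by (apply lt_0_INR; lia).
    replace (INR (S n) / INR n) with (1 + / INR n) by (rewrite S_INR; field; lra).
    assert (Hi : 0 < / INR n) by (apply Rinv_0_lt_compat; lra).
    rewrite <- (ln_exp (/ INR n)) at 2.
    destruct (exp_ineq1_le (/ INR n)) as [Hlt | ->]; [apply Rlt_le, ln_increasing; lra | apply Rle_refl]. }
  destruct (Hcs n Hn2) as [C1 S1]; destruct (Hcs (S n) ltac:(lia)) as [C2 S2].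
  assert (Hcos : cos (Rabs t * r) = 1).
  { replace (cos (Rabs t * r)) with (cos (t * r)).
    - unfold r; rewrite Rmult_minus_distr_l, cos_minus, C1, C2, S1, S2; ring.
    - unfold Rabs; destruct (Rcase_abs t); [| reflexivity].
      rewrite <- cos_neg; f_equal; ring. }
  assert (Hsmall : Rabs t * r <= 1).
  { apply Rle_trans with (Rabs t * / INR n); [now apply Rmult_le_compat_l |].
    apply Rmult_le_reg_r with (INR n); [lra |]. rewrite Rmult_assoc, Rinv_l by lra; lra. }
  destruct (Rle_lt_or_eq_dec 0 (Rabs t) Ht) as [Hlt | Heq].
  - exfalso. pose proof PI2_1 as HPI.
    assert (cos (Rabs t * r) < cos 0); [| rewrite cos_0 in *; lra].
    apply cos_decreasing_1; nra.
  - apply NNPP; intros Hne; apply Rabs_pos_lt in Hne; lra.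
Qed.

(** * Sufficiency: the symbols cs + i tau *)

(** Composition sends n^{-s} to n^{-i tau} (n^c)^{-s}. The factor n^{-i tau} has modulus 1 and n ->
    n^c is strictly increasing for c >= 1, so coefficients are rotated and moved without merging. *)
Lemma affine_isometry (phi : C -> C) (c : nat) (tau : R) :
  (1 <= c)%nat -> (forall s, in_half_plane 0 s -> in_half_plane 0 (phi s)) ->
  (forall s, in_half_plane 0 s -> phi s = Cplus (Cmult (RtoC (INR c)) s) (iR tau)) ->
  Cphi_isometry phi.
Proof.
  intros Hc Hmaps Hphi f a b [Ha Ra] Hb Rb.
  set (sigma := fun k => pred (S k ^ c)).
  assert (HS : forall k, S (sigma k) = (S k ^ c)%nat).
  { intros k; unfold sigma; pose proof (pow_ge_1 (S k) c ltac:(lia)); lia. }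
  assert (Hs : increasing_seq sigma).
  { intros k; apply Nat.succ_lt_mono; rewrite !HS; apply Nat.pow_lt_mono_l; lia. }
  set (a' := fun n => Cmult (a n) (npow_neg n (iR tau))).
  assert (Na' : is_series (fun k => Cmod (a' (S k))) (l1_norm a)).
  { generalize (Series_correct _ Ha); apply is_series_ext; intros k; unfold a'.
    rewrite Cmod_mult, Cmod_npow_neg; simpl Re.
    rewrite Ropp_0, Rmult_0_l, exp_0, Rmult_1_r; reflexivity. }
  assert (Np := push_coeffs_norm sigma a' _ Hs Na').
  assert (Hp : Aplus_rep (push_coeffs sigma a') (fun s => f (phi s))).
  { split; [now exists (l1_norm a) |].
    apply push_coeffs_represents; [exact Hs |]; intros s HU.
    assert (HU' : in_closed_rhp (phi s)) by (apply Rlt_le, (Hmaps s HU)).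
    generalize (Ra _ HU'); apply is_cseries_ext; intros k; unfold ds_term, a'.
    rewrite HS, (Hphi s HU), npow_neg_plus, npow_neg_INR_mult, npow_neg_pow by lia; ring. }
  (* The sequence [b] is an arbitrary representation of the composite; uniqueness of coefficients
     identifies it with the reindexed one. *)
  rewrite <- (is_series_unique _ _ Np); apply Series_ext; intros k; f_equal.
  apply (coeff_unique _ _ (fun s => f (phi s))); [now split | exact Hp | lia].
Qed.

(** * Necessity, and the resulting characterization *)

Theorem theorem22 (phi : C -> C) (c0 : nat) (varphi : C -> C)
  (Hmaps : forall s, in_half_plane 0 s -> in_half_plane 0 (phi s))
  (Hanal : analytic_on (in_half_plane 0) phi)
  (Hnc : exists s1 s2, in_half_plane 0 s1 /\ in_half_plane 0 s2 /\ phi s1 <> phi s2)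
  (HvD : in_D varphi)
  (Hform : forall s, in_half_plane 0 s -> phi s = Cplus (Cmult (RtoC (INR c0)) s) (varphi s))
  (Hop : Cphi_maps_Aplus phi) :
  Cphi_isometry phi <->
  exists (c : nat) (tau : R), (1 <= c)%nat /\
    forall s, in_half_plane 0 s -> phi s = Cplus (Cmult (RtoC (INR c)) s) (iR tau).
Proof.
  split; [| intros [c [tau [Hc Hphi]]]; now apply affine_isometry with c tau].
  intros Hiso.
  destruct HvD as [_ [cs [sigma Hcs]]].
  destruct (dirichlet_series_limit cs varphi sigma Hcs) as [l Hl].
  assert (Hex : forall k, (1 <= k)%nat -> exists d, Aplus_rep d (fun s => npow_neg k (phi s))).
  { intros k Hk.
    destruct (Hop (fun s => Cmult (RtoC 1) (npow_neg k s))) as [d [Sd Rd]].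
    - exists (single k (RtoC 1)); split; [now apply abs_summable_single | now apply represents_single].
    - exists d; split; [exact Sd |].
      apply represents_on_ext with (2 := Rd); intros s _; ring. }
  assert (Hmono : forall n s, (2 <= n)%nat -> in_half_plane 0 s ->
    npow_neg n (varphi s) = npow_neg n l).
  { intros n s Hn Hs; destruct (Hex n ltac:(lia)) as [b Hb].
    destruct (lead_coeff_npow phi varphi c0 l n b Hform Hl ltac:(lia) Hb) as [_ E].
    assert (Z := isometry_monomial phi varphi c0 l n b Hform Hl Hiso Hex Hn Hb).
    assert (HA : (1 <= n ^ c0)%nat) by (apply pow_ge_1; lia).
    (* With a single nonzero coefficient, the series of n^{-phi} reduces to one monomial on the
       whole half-plane; dividing by (n^{-s})^{c0} leaves n^{-varphi}. *)
    assert (Hu : npow_neg n (phi s) = Cmult (npow_neg n l) (npow_neg (n ^ c0) s)).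
    { apply is_cseries_unique with (ds_term b s); [apply (proj2 Hb s Hs) |].
      generalize (represents_single _ (n ^ c0) (npow_neg n l) HA s Hs).
      apply is_cseries_ext; intros k; unfold ds_term, single; f_equal.
      destruct (Nat.eqb_spec (S k) (n ^ c0)) as [-> | Hk]; [now symmetry |].
      symmetry; apply Z; [lia | exact Hk]. }
    rewrite (Hform s Hs), npow_neg_plus, npow_neg_INR_mult, npow_neg_pow in Hu by lia.
    rewrite Cmult_comm in Hu.
    assert (Hnz : Cpow (npow_neg n s) c0 <> RtoC 0) by apply Cpow_nz, npow_neg_neq_0.
    transitivity (Cmult (Cmult (npow_neg n (varphi s)) (Cpow (npow_neg n s) c0))
                    (Cinv (Cpow (npow_neg n s) c0))); [field; exact Hnz |].
    rewrite Hu; field; exact Hnz. }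
  assert (Hconst : forall s, in_half_plane 0 s -> varphi s = l).
  { intros s Hs; assert (E : Cminus (varphi s) l = RtoC 0).
    - apply npow_neg_inj; intros n Hn; unfold Cminus.
      rewrite npow_neg_plus, (Hmono n s Hn Hs), Cmult_comm; apply npow_neg_opp.
    - replace (varphi s) with (Cplus (Cminus (varphi s) l) l) by ring; rewrite E; ring. }
  (* The monomial 2^{-phi} has norm |2^{-l}|, which the isometry forces to be 1. *)
  assert (Hre : Re l = 0).
  { destruct (Hex 2%nat ltac:(lia)) as [b Hb].
    destruct (lead_coeff_npow phi varphi c0 l 2 b Hform Hl ltac:(lia) Hb) as [_ E].
    assert (Z := isometry_monomial phi varphi c0 l 2 b Hform Hl Hiso Hex ltac:(lia) Hb).
    assert (HA : (1 <= 2 ^ c0)%nat) by (apply pow_ge_1; lia).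
    assert (N := isometry_norm phi 2 b Hiso ltac:(lia) Hb).
    assert (N' : l1_norm b = Cmod (npow_neg 2 l)).
    { rewrite <- (is_series_unique _ _ (single_norm (2 ^ c0) (npow_neg 2 l) HA)).
      apply Series_ext; intros k; f_equal; unfold single.
      destruct (Nat.eqb_spec (S k) (2 ^ c0)) as [-> | Hk]; [exact E | apply Z; [lia | exact Hk]]. }
    rewrite N, Cmod_npow_neg, <- exp_0 in N'; apply exp_inv in N'.
    assert (0 < ln (INR 2)) by (rewrite <- ln_1; apply ln_increasing; simpl; lra). nra. }
  exists c0, (Im l); split.
  (* If c0 = 0, the supports of 1^{-phi} and 2^{-phi} both contain the index 1, against
     disjointness. *)
  - destruct c0 as [|c0]; [exfalso | lia].
    destruct (Hex 1%nat ltac:(lia)) as [b1 H1], (Hex 2%nat ltac:(lia)) as [b2 H2].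
    destruct (lead_coeff_npow phi varphi 0 l 1 b1 Hform Hl ltac:(lia) H1) as [_ E1].
    destruct (lead_coeff_npow phi varphi 0 l 2 b2 Hform Hl ltac:(lia) H2) as [_ E2].
    simpl in E1, E2.
    destruct (isometry_disjoint phi 1 2 b1 b2 1 Hiso) as [E | E]; auto.
    + rewrite E in E1; exact (npow_neg_neq_0 1 l (eq_sym E1)).
    + rewrite E in E2; exact (npow_neg_neq_0 2 l (eq_sym E2)).
  - intros s Hs; rewrite (Hform s Hs), (Hconst s Hs); f_equal.
    apply C_ext; [exact Hre | reflexivity].
Qed.
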